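(* Let $G$ be a complex linear algebraic group and let $\mathcal{E}$ be a $T$-equivariant holomorphic (resp. algebraic) principal $G$-bundle over a nonsingular complex toric variety $X$ (not necessarily affine) with torus $T=(\mathbb{C}^* )^n$. Let $\mathrm{Aut}_T(\mathcal{E})$ be the group of $T$-equivariant automorphisms of $\mathcal{E}$ that project to the identity map on $X$. Then $\mathrm{Aut}_T(\mathcal{E})$ is a subgroup of $G$ that contains the center $Z(G)$ of $G$.
   Context: A $T$-equivariant holomorphic (resp. algebraic) principal $G$-bundle on $X$ is a holomorphic (resp. algebraic) principal $G$-bundle $\pi:\mathcal{E}\to X$ (right $G$-action) with a holomorphic (resp. algebraic) left $T$-action on $\mathcal{E}$ such that $\pi$ is $T$-equivariant and $t(z\cdot g)=(tz)\cdot g$ for all $t\in T$, $g\in G$, $z\in\mathcal{E}$. *)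

(* Defs.v *)
From HB Require Import structures.
From mathcomp Require Import all_boot all_order all_algebra.
From mathcomp Require Import all_classical all_reals all_analysis.
From mathcomp Require Import complex.

Set Implicit Arguments.
Unset Strict Implicit.
Unset Printing Implicit Defensive.

Import Order.TTheory GRing.Theory Num.Theory.
Import numFieldNormedType.Exports.

Local Open Scope classical_set_scope.
Local Open Scope ring_scope.

(* The complex numbers, as a type on which the normed topology is inferred. *)
Definition Cplx (R : realType) : numFieldType := R[i].

(******************************************************************************)
(* Varieties and complex manifolds are treated uniformly as spaces with       *)
(* functions (Serre): a set X, a topology on it, and a sheaf of C-valued     *)
(* functions. A function defined on an open set U is represented by a total   *)
(* function X -> C of which only the values on U matter.                      *)
(* - Algebraic: the functions form a sheaf of C-algebras, and for f regular,  *)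
(*   {f != 0} is open and 1/f is regular on it.                               *)
(* - Holomorphic: the functions are stable under composition with holomorphic *)
(*   functions of several variables (in particular they form a sheaf of       *)
(*   C-algebras with continuous elements).                                    *)
(******************************************************************************)

Inductive category := Algebraic | Holomorphic.

Section Spaces.
Variable R : realType.
Local Notation C := (Cplx R).

Definition stable_functions (k : category) (X : Type)
    (opn : set X -> Prop) (reg : set X -> (X -> C) -> Prop) : Prop :=
  match k with
  | Algebraic =>
    [/\ forall U c, opn U -> reg U (fun=> c),
        forall U f g, reg U f -> reg U g -> reg U (fun x => f x + g x),
        forall U f g, reg U f -> reg U g -> reg U (fun x => f x * g x) &
        forall U f, reg U f ->
          opn (U `&` [set x | f x != 0]) /\
          reg (U `&` [set x | f x != 0]) (fun x => (f x)^-1)]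
  | Holomorphic =>
    forall (m : nat) (U : set X) (g : X -> 'rV[C]_m)
           (Om : set 'rV[C]_m) (F : 'rV[C]_m -> C^o),
      opn U -> (forall j, reg U (fun x => g x ord0 j)) ->
      open Om -> (forall v, Om v -> differentiable F v) ->
      opn (U `&` g @^-1` Om) /\ reg (U `&` g @^-1` Om) (F \o g)
  end.

Record fspace_axioms (k : category) (X : Type)
    (opn : set X -> Prop) (reg : set X -> (X -> C) -> Prop) : Prop :=
  FspaceAxioms {
    fs_setT : opn setT;
    fs_setI : forall U V, opn U -> opn V -> opn (U `&` V);
    fs_union : forall U : set X,
      (forall x, U x -> exists V, [/\ opn V, V x & V `<=` U]) -> opn U;
    fs_reg_open : forall U f, reg U f -> opn U;
    (* gluing, restriction and independence of the values outside U *)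
    fs_local : forall U f, opn U ->
      (forall x, U x -> exists V g,
         [/\ V x, reg V g & forall y, U y -> V y -> f y = g y]) -> reg U f;
    fs_stable : stable_functions k opn reg }.

Record fspace (k : category) (X : Type) := Fspace {
  opn : set X -> Prop;
  reg : set X -> (X -> C) -> Prop;
  fspaceP : fspace_axioms k opn reg }.

(* The smallest structure for which every f with [gens U f] is defined and    *)
(* regular on U.                                                              *)
Definition generated_opn (k : category) (X : Type)
    (gens : set X -> (X -> C) -> Prop) (U : set X) : Prop :=
  forall opn' reg', fspace_axioms k opn' reg' ->
    (forall V f, gens V f -> reg' V f) -> opn' U.

Definition generated_reg (k : category) (X : Type)
    (gens : set X -> (X -> C) -> Prop) (U : set X) (f : X -> C) : Prop :=
  forall opn' reg', fspace_axioms k opn' reg' ->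
    (forall V f, gens V f -> reg' V f) -> reg' U f.

Lemma generated_axioms (k : category) (X : Type)
    (gens : set X -> (X -> C) -> Prop) :
  fspace_axioms k (generated_opn k gens) (generated_reg k gens).
Proof.
split.
- by move=> o r ax _; exact: (fs_setT ax).
- by move=> U V oU oV o r ax h; apply: (fs_setI ax); [exact: (oU _ _ ax h)|exact: (oV _ _ ax h)].
- move=> U hU o r ax h; apply: (fs_union ax) => x /hU[V [oV Vx VU]].
  by exists V; split => //; exact: (oV _ _ ax h).
- by move=> U f rf o r ax h; apply: (fs_reg_open ax); exact: (rf _ _ ax h).
- move=> U f oU hU o r ax h; apply: (fs_local ax); first exact: (oU _ _ ax h).
  move=> x /hU[V [g [Vx rg e]]]; exists V, g; split=> //; exact: (rg _ _ ax h).
- case: k => /=.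
  + split=> [U c oU|U f g rf rg|U f g rf rg|U f rf].
    * move=> o r ax h; have /= [s _ _ _] := fs_stable ax.
      by apply: s; exact: (oU _ _ ax h).
    * move=> o r ax h; have /= [_ s _ _] := fs_stable ax.
      by apply: s; [exact: (rf _ _ ax h)|exact: (rg _ _ ax h)].
    * move=> o r ax h; have /= [_ _ s _] := fs_stable ax.
      by apply: s; [exact: (rf _ _ ax h)|exact: (rg _ _ ax h)].
    * by split=> o r ax h; have /= [_ _ _ s] := fs_stable ax;
        have [] := s U f (rf _ _ ax h).
  + move=> m U g Om F oU rg oOm dF; split=> o r ax h;
      have /= s := fs_stable ax;
      by have [] := s m U g Om F (oU _ _ ax h) (fun j => rg j _ _ ax h) oOm dF.
Qed.

Definition generated (k : category) (X : Type)
    (gens : set X -> (X -> C) -> Prop) : fspace k X :=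
  Fspace (generated_axioms k gens).

Definition pullback_gens (k : category) (X Y : Type) (S : fspace k Y)
    (f : X -> Y) : set X -> (X -> C) -> Prop :=
  fun U h => exists V g, [/\ reg S V g, U = f @^-1` V & h = g \o f].

Definition subspace (k : category) (X : Type) (S : fspace k X) (P : set X) :
    fspace k {x | P x} :=
  generated k (pullback_gens S (@sval X P)).

Definition product (k : category) (X Y : Type)
    (SX : fspace k X) (SY : fspace k Y) : fspace k (X * Y) :=
  generated k (fun U h => pullback_gens SX fst U h \/ pullback_gens SY snd U h).

(* C^m, with the Zariski topology and regular functions, resp. the usual      *)
(* topology and holomorphic functions.                                        *)
Definition affine_space (k : category) (m : nat) : fspace k 'rV[C]_m :=
  generated k (fun (U : set 'rV[C]_m) (h : 'rV[C]_m -> C) =>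
    U = setT /\ exists j, h = fun v => v ord0 j).

(* The complex analytic space of an algebraic variety: on an affine patch     *)
(* Z of C^m, the classical topology and the functions which are locally       *)
(* restrictions of holomorphic functions of m variables.                      *)
Definition analytification (X : Type) (S : fspace Algebraic X) :
    fspace Holomorphic X :=
  generated Holomorphic (reg S).

Definition realization (k : category) (X : Type) (S : fspace Algebraic X) :
    fspace k X :=
  match k with
  | Algebraic => S
  | Holomorphic => analytification S
  end.

Definition morphism (k : category) (X Y : Type)
    (SX : fspace k X) (SY : fspace k Y) (f : X -> Y) : Prop :=
  (forall V, opn SY V -> opn SX (f @^-1` V)) /\
  (forall V g, reg SY V g -> reg SX (f @^-1` V) (g \o f)).

Definition isomorphism (k : category) (X Y : Type)
    (SX : fspace k X) (SY : fspace k Y) (f : X -> Y) : Prop :=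
  exists g, [/\ morphism SX SY f, morphism SY SX g, cancel f g & cancel g f].

Definition isomorphic (k : category) (X Y : Type)
    (SX : fspace k X) (SY : fspace k Y) : Prop :=
  exists f, isomorphism SX SY f.

(* Varieties are not required to be irreducible.                              *)
Definition affine_variety (X : Type) (S : fspace Algebraic X) : Prop :=
  exists (m : nat) (Z : set 'rV[C]_m),
    opn (affine_space Algebraic m) (~` Z) /\
    isomorphic S (subspace (affine_space Algebraic m) Z).

Definition variety (X : Type) (S : fspace Algebraic X) : Prop :=
  (exists (N : nat) (U : 'I_N -> set X),
     (forall i, opn S (U i) /\ affine_variety (subspace S (U i))) /\
     (forall x, exists i, U i x)) /\
  opn (product S S) [set p | p.1 <> p.2].

Definition complex_manifold (X : Type) (S : fspace Holomorphic X) : Prop :=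
  [/\ forall x y, x <> y -> exists U V,
        [/\ opn S U, opn S V, U x, V y & U `&` V = set0],
      exists B : nat -> set X, (forall i, opn S (B i)) /\
        forall U x, opn S U -> U x -> exists i, B i x /\ B i `<=` U &
      forall x, exists (d : nat) (U : set X) (W : set 'rV[C]_d),
        [/\ opn S U, U x, open W &
            isomorphic (subspace S U) (subspace (affine_space Holomorphic d) W)]].

Definition variety_or_manifold (k : category) (X : Type) : fspace k X -> Prop :=
  match k with
  | Algebraic => @variety X
  | Holomorphic => @complex_manifold X
  end.

Section Etale.
Variables (Y X : Type) (SY : fspace Algebraic Y) (SX : fspace Algebraic X).
Variable f : Y -> X.

(* Flatness of the local ring of Y at y over the local ring of X at f y:      *)
(* every relation sum_i a_i b_i = 0, with a_i functions near f y and b_i      *)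
(* functions near y, comes from relations between the a_i.                    *)
Definition flat_at (y : Y) : Prop :=
  forall (r : nat) (U : set X) (W : set Y)
         (a : 'I_r -> X -> C) (b : 'I_r -> Y -> C),
    U (f y) -> W y ->
    (forall i, reg SX U (a i)) -> (forall i, reg SY W (b i)) ->
    (forall w, W w -> U (f w) -> \sum_(i < r) a i (f w) * b i w = 0) ->
  exists (s : nat) (U' : set X) (W' : set Y)
         (c : 'I_r -> 'I_s -> X -> C) (d : 'I_s -> Y -> C),
    [/\ U' (f y) /\ W' y,
        forall i j, reg SX U' (c i j),
        forall j, reg SY W' (d j),
        forall j x, U x -> U' x -> \sum_(i < r) a i x * c i j x = 0 &
        forall i w, W w -> W' w -> U' (f w) ->
          b i w = \sum_(j < s) c i j (f w) * d j w].

(* The maximal ideal at f y generates the maximal ideal at y.                 *)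
Definition unramified_at (y : Y) : Prop :=
  forall (W : set Y) (b : Y -> C), W y -> reg SY W b -> b y = 0 ->
  exists (r : nat) (U' : set X) (W' : set Y)
         (a : 'I_r -> X -> C) (c : 'I_r -> Y -> C),
    [/\ U' (f y) /\ W' y,
        forall i, reg SX U' (a i) /\ a i (f y) = 0,
        forall i, reg SY W' (c i) &
        forall w, W w -> W' w -> U' (f w) ->
          b w = \sum_(i < r) a i (f w) * c i w].

Definition etale : Prop :=
  morphism SY SX f /\ forall y, flat_at y /\ unramified_at y.

End Etale.

Definition linear_algebraic_group (G : groupType) (S : fspace Algebraic G) :
    Prop :=
  [/\ affine_variety S,
      morphism (product S S) S (fun p => (p.1 * p.2)%g) &
      morphism S S (fun g => (g^-1)%g)].

(******************************************************************************)
(* The torus of n-tuples of nonzero complex numbers                           *)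
(******************************************************************************)

Record torus (n : nat) := Torus {
  torus_val : 'I_n -> C;
  torus_neq0 : forall i, torus_val i != 0 }.

Definition torus_space (n : nat) : fspace Algebraic (torus n) :=
  generated Algebraic
    (fun (U : set (torus n)) (h : torus n -> C) =>
       U = setT /\ exists i, h = fun t => torus_val t i).

Lemma torus_inj n : injective (@torus_val n).
Proof.
case=> s hs [t ht] /= e; case: _ / e in ht *.
by congr Torus; exact: Prop_irrelevance.
Qed.

HB.instance Definition _ n := gen_eqMixin (torus n).
HB.instance Definition _ n := gen_choiceMixin (torus n).

Definition torus1 n : torus n := @Torus n (fun=> 1) (fun=> oner_neq0 _).

Definition torusM n (s t : torus n) : torus n :=
  @Torus n (fun i => torus_val s i * torus_val t i)
    (fun i => mulf_neq0 (torus_neq0 s i) (torus_neq0 t i)).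

Definition torusV n (t : torus n) : torus n :=
  @Torus n (fun i => (torus_val t i)^-1)
    (fun i => invr_neq0 (torus_neq0 t i)).

Lemma torusMA n : associative (@torusM n).
Proof. by move=> r s t; apply: torus_inj; apply: funext => i; exact: mulrA. Qed.

Lemma torus1M n : left_id (torus1 n) (@torusM n).
Proof. by move=> t; apply: torus_inj; apply: funext => i; exact: mul1r. Qed.

Lemma torusM1 n : right_id (torus1 n) (@torusM n).
Proof. by move=> t; apply: torus_inj; apply: funext => i; exact: mulr1. Qed.

Lemma torusVM n : left_inverse (torus1 n) (@torusV n) (@torusM n).
Proof.
move=> t; apply: torus_inj; apply: funext => i; apply: mulVf.
exact: torus_neq0.
Qed.

Lemma torusMV n : right_inverse (torus1 n) (@torusV n) (@torusM n).
Proof.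
move=> t; apply: torus_inj; apply: funext => i; apply: mulfV.
exact: torus_neq0.
Qed.

HB.instance Definition _ n := isGroup.Build (torus n)
  (@torusMA n) (@torus1M n) (@torusM1 n) (@torusVM n) (@torusMV n).

(* The character chi^m of the torus. *)
Definition torus_char n (m : 'rV[int]_n) (t : torus n) : C :=
  \prod_(i < n) (torus_val t i) ^ (m ord0 i).

(******************************************************************************)
(* Toric varieties: fans in N_R = R^n with N = Z^n, dual lattice M = Z^n      *)
(******************************************************************************)

Definition lattice_vector n (m : 'rV[int]_n) : 'rV[R]_n :=
  map_mx (fun z : int => z%:~R) m.

Definition pairing n (u v : 'rV[R]_n) : R := \sum_(i < n) u ord0 i * v ord0 i.

Definition cone_over n (s : seq 'rV[int]_n) : set 'rV[R]_n :=
  [set v | exists2 c : 'I_(size s) -> R, (forall i, 0 <= c i) &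
             v = \sum_(i < size s) c i *: lattice_vector (nth 0 s i)].

Definition is_face n (tau sigma : set 'rV[R]_n) : Prop :=
  exists u : 'rV[R]_n, (forall v, sigma v -> 0 <= pairing u v) /\
    tau = sigma `&` [set v | pairing u v = 0].

Record is_fan n (Sigma : set (set 'rV[R]_n)) : Prop := IsFan {
  fan_finite : finite_set Sigma;
  fan_nonempty : Sigma !=set0;
  fan_rational : forall sigma, Sigma sigma -> exists s, sigma = cone_over s;
  fan_pointed : forall sigma v, Sigma sigma ->
    sigma v -> sigma (- v) -> v = 0;
  fan_faces : forall sigma tau, Sigma sigma -> is_face tau sigma -> Sigma tau;
  fan_inter : forall sigma tau, Sigma sigma -> Sigma tau ->
    is_face (sigma `&` tau) sigma /\ is_face (sigma `&` tau) tau }.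

(* Every cone is generated by a part of a Z-basis of N. *)
Definition smooth_fan n (Sigma : set (set 'rV[R]_n)) : Prop :=
  is_fan Sigma /\
  forall sigma, Sigma sigma -> exists (B : 'M[int]_n) (I : {set 'I_n}),
    B \in unitmx /\ sigma = cone_over [seq row i B | i <- enum I].

Definition dual_monoid n (sigma : set 'rV[R]_n) : set 'rV[int]_n :=
  [set m | forall v, sigma v -> 0 <= pairing (lattice_vector m) v].

(* The points of U_sigma = Spec C[S_sigma], S_sigma = dual_monoid sigma, i.e. *)
(* the monoid morphisms S_sigma -> (C, * ), extended by 0 outside S_sigma.    *)
Record affine_toric n (sigma : set 'rV[R]_n) := AffineToric {
  at_val :> 'rV[int]_n -> C;
  at_out : forall m, ~ dual_monoid sigma m -> at_val m = 0;
  at_one : at_val 0 = 1;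
  at_mul : forall m m', dual_monoid sigma m -> dual_monoid sigma m' ->
    at_val (m + m') = at_val m * at_val m' }.

Definition affine_toric_space n (sigma : set 'rV[R]_n) :
    fspace Algebraic (affine_toric sigma) :=
  generated Algebraic (fun (U : set (affine_toric sigma))
                           (h : affine_toric sigma -> C) =>
    U = setT /\ exists2 m, dual_monoid sigma m & h = fun x => x m).

(* X, with its action of the torus, is the toric variety of the fan Sigma:    *)
(* it is obtained by gluing the U_sigma along the U_tau, tau a face of sigma. *)
Definition toric_variety_of n (Sigma : set (set 'rV[R]_n)) (X : Type)
    (S : fspace Algebraic X) (act : torus n -> X -> X) : Prop :=
  exists (U : set 'rV[R]_n -> set X)
         (phi : forall sigma, {x | U sigma x} -> affine_toric sigma),
  [/\ forall sigma, Sigma sigma -> opn S (U sigma) /\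
        isomorphism (subspace S (U sigma)) (affine_toric_space sigma)
          (phi sigma),
      forall x, exists2 sigma, Sigma sigma & U sigma x,
      forall sigma tau, Sigma sigma -> Sigma tau ->
        U (sigma `&` tau) = U sigma `&` U tau,
      forall sigma tau, Sigma sigma -> Sigma tau -> is_face tau sigma ->
        forall x (xs : U sigma x) (xt : U tau x) m, dual_monoid sigma m ->
          phi tau (exist _ x xt) m = phi sigma (exist _ x xs) m &
      forall sigma, Sigma sigma -> forall t x (xs : U sigma x),
        exists txs : U sigma (act t x), forall m, dual_monoid sigma m ->
          phi sigma (exist _ (act t x) txs) m =
          torus_char m t * phi sigma (exist _ x xs) m].

Definition nonsingular_toric_variety n (X : Type) (S : fspace Algebraic X)
    (act : torus n -> X -> X) : Prop :=
  exists2 Sigma, smooth_fan Sigma & toric_variety_of Sigma S act.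

(******************************************************************************)
(* Principal bundles                                                          *)
(******************************************************************************)

Section Trivial.
Variables (k : category) (G : groupType) (E X : Type).
Variables (SG : fspace k G) (SE : fspace k E).
Variables (pi : E -> X) (act : E -> G -> E).

(* The pullback of E along f : U -> X is trivial. *)
Definition trivial_along (U : Type) (SU : fspace k U) (f : U -> X) : Prop :=
  exists Phi : U * G -> {p : U * E | f p.1 = pi p.2},
  [/\ isomorphism (product SU SG)
        (subspace (product SU SE) (fun p => f p.1 = pi p.2)) Phi,
      forall u g, (sval (Phi (u, g))).1 = u &
      forall u g h,
        (sval (Phi (u, (g * h)%g))).2 = act (sval (Phi (u, g))).2 h].

End Trivial.

(* Local triviality is meant in the etale topology in the algebraic case, in  *)
(* the classical topology in the holomorphic case.                            *)
Definition locally_trivial (k : category) (G : groupType) (E X : Type) :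
    fspace k G -> fspace k E -> fspace k X ->
    (E -> X) -> (E -> G -> E) -> Prop :=
  match k with
  | Algebraic => fun SG SE SX pi act => forall x : X,
      exists (U : Type) (SU : fspace Algebraic U) (f : U -> X),
        [/\ variety SU, etale SU SX f, exists u, f u = x &
            trivial_along SG SE pi act SU f]
  | Holomorphic => fun SG SE SX pi act => forall x : X,
      exists V : set X,
        [/\ opn SX V, V x & trivial_along SG SE pi act (subspace SX V) sval]
  end.

(* Principal bundles over X (resp. its analytification) with structure group  *)
(* G (resp. its analytification), equivariant for the torus action actX on X. *)
Record equivariant_bundle (k : category) (n : nat) (G : groupType)
    (SG : fspace Algebraic G) (X : Type) (SX : fspace Algebraic X)
    (actX : torus n -> X -> X) := EquivariantBundle {
  total : Type;
  total_space : fspace k total;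
  proj : total -> X;
  actG : total -> G -> total;
  actT : torus n -> total -> total;
  total_geometric : variety_or_manifold total_space;
  proj_morphism : morphism total_space (realization k SX) proj;
  actG_morphism : morphism (product total_space (realization k SG))
    total_space (fun p => actG p.1 p.2);
  actT_morphism : morphism (product (realization k (torus_space n)) total_space)
    total_space (fun p => actT p.1 p.2);
  actG1 : forall z, actG z 1%g = z;
  actGM : forall z g h, actG z (g * h)%g = actG (actG z g) h;
  actT1 : forall z, actT 1%g z = z;
  actTM : forall s t z, actT (s * t)%g z = actT s (actT t z);
  proj_actG : forall z g, proj (actG z g) = proj z;
  proj_actT : forall t z, proj (actT t z) = actX t (proj z);
  actT_actG : forall t z g, actT t (actG z g) = actG (actT t z) g;
  bundle_locally_trivial : locally_trivial (realization k SG) total_space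
    (realization k SX) proj actG }.

(******************************************************************************)
(* The group of T-equivariant automorphisms over the identity of X            *)
(******************************************************************************)

Section Automorphisms.
Variables (k : category) (n : nat) (G : groupType).
Variables (SG : fspace Algebraic G) (X : Type) (SX : fspace Algebraic X).
Variables (actX : torus n -> X -> X) (E : equivariant_bundle k SG SX actX).

Record is_autT (phi : total E -> total E) : Prop := IsAutT {
  autT_iso : isomorphism (total_space E) (total_space E) phi;
  autT_proj : forall z, proj (phi z) = proj z;
  autT_actG : forall z g, phi (actG z g) = actG (phi z) g;
  autT_actT : forall t z, phi (actT t z) = actT t (phi z) }.

Record autT := AutT { autT_fun :> total E -> total E; autTP : is_autT autT_fun }.

Lemma autT_inj (a b : autT) : a =1 b -> a = b.
Proof.
case: a b => a ha [b hb] /= /funext e; case: _ / e in hb *.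
by congr AutT; exact: Prop_irrelevance.
Qed.

HB.instance Definition _ := gen_eqMixin autT.
HB.instance Definition _ := gen_choiceMixin autT.

Lemma is_autT_id : is_autT id.
Proof. by split=> //; exists id; split=> //; split. Qed.

Lemma is_autT_comp a b : is_autT a -> is_autT b -> is_autT (a \o b).
Proof.
case=> -[a' [[am am'] [a'm a'm'] aK a'K]] pa ga ta.
case=> -[b' [[bm bm'] [b'm b'm'] bK b'K]] pb gb tb.
split=> /= [|z|z g|t z]; last 3 first.
- by rewrite pa pb.
- by rewrite gb ga.
- by rewrite tb ta.
exists (b' \o a'); split.
- split=> [V oV|V g rg]; first exact: (bm _ (am _ oV)).
  exact: (bm' _ _ (am' _ _ rg)).
- split=> [V oV|V g rg]; first exact: (a'm _ (b'm _ oV)).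
  exact: (a'm' _ _ (b'm' _ _ rg)).
- exact: can_comp.
- exact: can_comp.
Qed.

Lemma autT_inv_ex (a : autT) :
  exists b : autT, cancel a b /\ cancel b a.
Proof.
case: a => a [[a' [ma ma' aK a'K]] pa ga ta] /=.
suff ha' : is_autT a' by exists (AutT ha').
split=> [|z|z g|t z].
- by exists a.
- by rewrite -[in RHS](a'K z) pa.
- by apply: (can_inj aK); rewrite ga !a'K.
- by apply: (can_inj aK); rewrite ta !a'K.
Qed.

Definition autT1 : autT := AutT is_autT_id.
Definition autTM (a b : autT) : autT := AutT (is_autT_comp (autTP a) (autTP b)).
Definition autTV (a : autT) : autT := sval (cid (autT_inv_ex a)).

Lemma autTMA : associative autTM.
Proof. by move=> a b c; exact: autT_inj. Qed.

Lemma autT1M : left_id autT1 autTM.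
Proof. by move=> a; exact: autT_inj. Qed.

Lemma autTM1 : right_id autT1 autTM.
Proof. by move=> a; exact: autT_inj. Qed.

Lemma autTVM : left_inverse autT1 autTV autTM.
Proof.
by move=> a; apply: autT_inj => z; exact: (svalP (cid (autT_inv_ex a))).1.
Qed.

Lemma autTMV : right_inverse autT1 autTV autTM.
Proof.
by move=> a; apply: autT_inj => z; exact: (svalP (cid (autT_inv_ex a))).2.
Qed.

HB.instance Definition _ := isGroup.Build autT autTMA autT1M autTM1 autTVM autTMV.

End Automorphisms.

Definition group_center (G : groupType) : set G := [set c | forall g, commute c g].

End Spaces.

(* Main.v *)
(* Fix z0 in E over a point x0 of the open orbit O of X, and let rho a be the
   element of G with a z0 = z0 . rho a. If rho a = rho b, then a and b agree on
   the fibers over O = T x0 by equivariance. They then agree on all of E: the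
   set where a and b differ is open, because E is Hausdorff (resp. separated),
   and the preimage of O meets every nonempty open subset of E. Indeed O is
   dense in X, as every point of X is the value at 0 of a curve C -> X which
   maps the nonzero numbers to O, and density passes to E along local sections
   of E over open sets (resp. over etale, hence flat, maps). *)
Require Import Defs.
From mathcomp Require Import all_boot all_order all_algebra.
From mathcomp Require Import all_classical all_reals all_analysis.

Set Implicit Arguments.
Unset Strict Implicit.
Unset Printing Implicit Defensive.

Import Order.TTheory GRing.Theory Num.Theory.
Import numFieldNormedType.Exports.

Local Open Scope classical_set_scope.
Local Open Scope ring_scope.

(** * Morphisms of spaces with functions *)

Section Fspace.
Variables (R : realType) (k : category).
Local Notation C := (Cplx R).

Lemma opn_set0 X (S : fspace R k X) : opn S set0.
Proof. by apply: (fs_union (fspaceP S)). Qed.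

Lemma reg_set0 X (S : fspace R k X) f : reg S set0 f.
Proof. by apply: (fs_local (fspaceP S)) => //; exact: opn_set0. Qed.

Lemma reg_ext X (S : fspace R k X) U f g :
  reg S U f -> (forall x, U x -> g x = f x) -> reg S U g.
Proof.
move=> rf e; apply: (fs_local (fspaceP S)).
  exact: (fs_reg_open (fspaceP S) rf).
by move=> x Ux; exists U, f; split=> // y _ /e.
Qed.

Lemma reg_cst X (S : fspace R k X) U c : opn S U -> reg S U (fun=> c).
Proof.
move=> oU; have := fs_stable (fspaceP S).
case: k S oU => S oU; first by case=> h _ _ _; exact: h.
(* A constant is a holomorphic function of zero variables. *)
move=> h; have [] := h 0%N U (fun=> const_mx 0) setT (fun=> c) oU _ openT _;
    last by rewrite setIT.
- by case.
- by move=> v _; exact: differentiable_cst.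
Qed.

Lemma reg_restrict X (S : fspace R k X) U V f :
  reg S U f -> opn S V -> V `<=` U -> reg S V f.
Proof.
move=> rf oV VU; apply: (fs_local (fspaceP S)) => // x Vx.
by exists U, f; split=> //; exact: VU.
Qed.

(** This is the largest structure on [Y] making [h] a morphism. A generated structure is the
    smallest one containing its generators, so it lies inside this one as soon as they do; morphisms
    into generated spaces are checked in this way. *)
Lemma coinduced_axioms X Y (S : fspace R k X) (h : X -> Y) :
  fspace_axioms k (fun V => opn S (h @^-1` V))
    (fun V f => reg S (h @^-1` V) (f \o h)).
Proof.
have ax := fspaceP S; split.
- exact: (fs_setT ax).
- by move=> U V; exact: (fs_setI ax).
- move=> U hU; apply: (fs_union ax) => x /hU[V [oV Vx VU]].
  by exists (h @^-1` V); split => // y; exact: VU.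
- by move=> U f; exact: (fs_reg_open ax).
- move=> U f oU hU; apply: (fs_local ax) => // x /hU[V [g [Vx rg e]]].
  by exists (h @^-1` V), (g \o h); split=> // y; exact: e.
- have := fs_stable ax; case: k S {ax} => S.
    case=> s1 s2 s3 s4; split=> [U c|U f g|U f g|U f]; first exact: s1.
    + exact: s2.
    + exact: s3.
    + exact: s4.
  by move=> s m U g Om F oU rg oOm dF; exact: (s m _ (g \o h)).
Qed.

Lemma opn_generated X Y (S : fspace R k X) gens (h : X -> Y) V :
  (forall U f, gens U f -> reg S (h @^-1` U) (f \o h)) ->
  opn (generated k gens) V -> opn S (h @^-1` V).
Proof. by move=> hg oV; exact: (oV _ _ (coinduced_axioms S h)). Qed.

Lemma morphism_generated X Y (S : fspace R k X) gens (h : X -> Y) :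
  (forall U f, gens U f -> reg S (h @^-1` U) (f \o h)) ->
  morphism S (generated k gens) h.
Proof.
move=> hg; split=> [V oV|V f rf]; first exact: opn_generated oV.
exact: (rf _ _ (coinduced_axioms S h)).
Qed.

Lemma reg_generated X (gens : set X -> (X -> C) -> Prop) U f :
  gens U f -> reg (generated k gens) U f.
Proof. by move=> g o r _; exact. Qed.

Lemma morphism_comp X Y Z (SX : fspace R k X) (SY : fspace R k Y)
    (SZ : fspace R k Z) (g : Y -> Z) (f : X -> Y) :
  morphism SY SZ g -> morphism SX SY f -> morphism SX SZ (g \o f).
Proof.
move=> [go gr] [fo fr]; split=> [V oV|V u ru]; first exact: (fo _ (go _ oV)).
exact: (fr _ _ (gr _ _ ru)).
Qed.

Lemma morphism_id X (S : fspace R k X) : morphism S S id.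
Proof. by []. Qed.

(** An open set is the domain of a regular constant, so the condition on functions implies the one
    on open sets. *)
Lemma morphism_reg X Y (SX : fspace R k X) (SY : fspace R k Y) (f : X -> Y) :
  (forall V g, reg SY V g -> reg SX (f @^-1` V) (g \o f)) ->
  morphism SX SY f.
Proof.
move=> h; split=> // V oV.
exact: (fs_reg_open (fspaceP SX) (h _ _ (reg_cst 0 oV))).
Qed.

Lemma morphism_cst X Y (SX : fspace R k X) (SY : fspace R k Y) (y : Y) :
  morphism SX SY (fun=> y).
Proof.
apply: morphism_reg => V g rg; have [Vy|Vy] := pselect (V y).
  rewrite (_ : _ @^-1` _ = setT); last by apply/seteqP; split.
  exact: (reg_cst _ (fs_setT (fspaceP SX))).
rewrite (_ : _ @^-1` _ = set0); last by apply/seteqP; split.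
exact: reg_set0.
Qed.

Lemma morphism_sval X (S : fspace R k X) (P : set X) :
  morphism (Defs.subspace S P) S sval.
Proof.
by apply: morphism_reg => V g rg; apply: reg_generated; exists V, g.
Qed.

Lemma morphism_snd X Y (SX : fspace R k X) (SY : fspace R k Y) :
  morphism (product SX SY) SY snd.
Proof.
by apply: morphism_reg => V g rg; apply: reg_generated; right; exists V, g.
Qed.

Lemma morphism_pair X Y Z (SX : fspace R k X) (SY : fspace R k Y)
    (SZ : fspace R k Z) (f : X -> Y) (g : X -> Z) :
  morphism SX SY f -> morphism SX SZ g ->
  morphism SX (product SY SZ) (fun x => (f x, g x)).
Proof.
move=> [_ fr] [_ gr]; apply: morphism_generated => U u.
by case=> -[V [v [rv -> ->]]]; [exact: fr|exact: gr].
Qed.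

(** For varieties the set is the preimage under [(f, g)] of the complement of the diagonal, open by
    separatedness. For manifolds the Hausdorff property gives a neighbourhood of each of its
    points. *)
Lemma opn_setC_agree X Y (SX : fspace R k X) (SY : fspace R k Y)
    (f g : X -> Y) :
  variety_or_manifold SY -> morphism SX SY f -> morphism SX SY g ->
  opn SX [set x | f x <> g x].
Proof.
move=> vY mf mg; have := morphism_pair mf mg.
case: k SX SY vY mf mg => SX SY.
  by case=> _ sep _ _ [fg _]; exact: (fg _ sep).
move=> [haus _ _] [fo _] [go _] _; apply: (fs_union (fspaceP SX)) => x /= fgx.
have [U [V [oU oV Ux Vx UV]]] := haus _ _ fgx.
exists (f @^-1` U `&` g @^-1` V); split=> //.
  by apply: (fs_setI (fspaceP SX)); [exact: fo|exact: go].
by move=> y [/= Uy Vy] e; have : set0 (f y) by rewrite -UV; split; rewrite // e.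
Qed.

End Fspace.

(** * Germs of continuous functions *)

Section Germ.
Variables (K : numFieldType) (T : topologicalType) (t0 : T).
Implicit Types (U V : set T) (f g : T -> K).

Definition germ_opn U : Prop := U t0 -> nbhs t0 U.

Definition germ_reg U f : Prop := U t0 -> nbhs t0 U /\ f @ t0 --> f t0.

Lemma germ_reg_local U f : germ_opn U ->
  (forall x, U x -> exists V g,
     [/\ V x, germ_reg V g & forall y, U y -> V y -> f y = g y]) ->
  germ_reg U f.
Proof.
move=> oU hU Ut; split; first exact: oU.
have [V [g [Vt /(_ Vt)[nV cg] e]]] := hU _ Ut.
rewrite e //; apply: cvg_trans cg; apply: near_eq_cvg.
by apply: filterS (filterI (oU Ut) nV) => y [Uy Vy]; rewrite e.
Qed.

Lemma germ_reg_cst U (c : K) : germ_opn U -> germ_reg U (fun=> c).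
Proof. by move=> oU Ut; split; [exact: oU|exact: cvg_cst]. Qed.

Lemma germ_regD U f g :
  germ_reg U f -> germ_reg U g -> germ_reg U (fun x => f x + g x).
Proof.
move=> rf rg Ut; have [nU cf] := rf Ut; have [_ cg] := rg Ut; split=> //.
exact: cvgD.
Qed.

Lemma germ_regM U f g :
  germ_reg U f -> germ_reg U g -> germ_reg U (fun x => f x * g x).
Proof.
move=> rf rg Ut; have [nU cf] := rf Ut; have [_ cg] := rg Ut; split=> //.
exact: cvgM.
Qed.

Lemma germ_opn_neq0 U f : germ_reg U f -> germ_opn (U `&` [set x | f x != 0]).
Proof.
move=> rf [Ut /= ft]; have [nU cf] := rf Ut; apply: filterI => //.
exact: (@cvgr_neq0 K K T _ _ f _ cf ft).
Qed.

Lemma germ_regV U f :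
  germ_reg U f -> germ_reg (U `&` [set x | f x != 0]) (fun x => (f x)^-1).
Proof.
move=> rf Ut; split; first exact: germ_opn_neq0 Ut.
by case: Ut => Ut /= ft; apply: cvgV => //; exact: (rf Ut).2.
Qed.

Lemma germ_reg_cvg_row m U (g : T -> 'rV[K]_m) :
  (forall j, germ_reg U (fun x => g x ord0 j)) -> U t0 -> g @ t0 --> g t0.
Proof.
move=> rg Ut A [P nP PA].
have nQ : nbhs t0 [set t | forall j, P ord0 j (g t ord0 j)].
  by apply: filter_forall => j; exact: ((rg j Ut).2 _ (nP ord0 j)).
by apply: filterS nQ => t Qt; apply: PA => i j; rewrite ord1; exact: Qt.
Qed.

Lemma germ_opn_preimage m U (g : T -> 'rV[K]_m) (Om : set 'rV[K]_m) :
  germ_opn U -> (forall j, germ_reg U (fun x => g x ord0 j)) -> open Om ->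
  germ_opn (U `&` g @^-1` Om).
Proof.
move=> oU rg oOm [Ut Ot]; apply: filterI; first exact: oU.
exact: (germ_reg_cvg_row rg Ut (open_nbhs_nbhs (conj oOm Ot))).
Qed.

(** [F] is continuous where it is differentiable, so continuous germs are stable under holomorphic
    functions. *)
Lemma germ_reg_comp m U (g : T -> 'rV[K]_m) (Om : set 'rV[K]_m)
    (F : 'rV[K]_m -> K^o) :
  germ_opn U -> (forall j, germ_reg U (fun x => g x ord0 j)) -> open Om ->
  (forall v, Om v -> differentiable F v) ->
  germ_reg (U `&` g @^-1` Om) (F \o g).
Proof.
move=> oU rg oOm dF Ot; split; first exact: germ_opn_preimage Ot.
case: Ot => Ut Ot; have /differentiable_continuous cF := dF _ Ot.
exact: cvg_comp (germ_reg_cvg_row rg Ut) cF.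
Qed.

Lemma germ_regX U f m : germ_reg U f -> germ_reg U (fun x => f x ^+ m).
Proof.
move=> rf; elim: m => [|m IH].
  by apply: germ_reg_cst => /rf[].
by under eq_fun do rewrite exprS; exact: germ_regM.
Qed.

Lemma germ_reg_prod (J : Type) (r : seq J) (P : pred J) (F : J -> T -> K) U :
  germ_opn U -> (forall j, P j -> germ_reg U (F j)) ->
  germ_reg U (fun x => \prod_(j <- r | P j) F j x).
Proof.
move=> oU rF; elim: r => [|j r IH].
  by under eq_fun do rewrite big_nil; exact: germ_reg_cst.
under eq_fun do rewrite big_cons; case: ifPn => // Pj.
exact: germ_regM (rF _ Pj) IH.
Qed.

End Germ.

Lemma germ_reg_id (K : numFieldType) (t0 : K) U :
  germ_opn t0 U -> germ_reg t0 U id.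
Proof. by move=> oU Ut; split; [exact: oU|exact: cvg_id]. Qed.

Section GermSpace.
Variables (R : realType) (k : category) (T : topologicalType) (t0 : T).

Lemma germ_axioms : fspace_axioms k (germ_opn t0) (@germ_reg (Cplx R) T t0).
Proof.
split.
- by move=> _; exact: filterT.
- by move=> U V oU oV [/oU nU /oV nV]; exact: filterI.
- by move=> U hU /hU[V [oV /oV nV VU]]; exact: filterS nV.
- by move=> U f rf /rf[].
- exact: germ_reg_local.
- case: k.
    split; [exact: germ_reg_cst|exact: germ_regD|exact: germ_regM|].
    by move=> U f rf; split; [exact: germ_opn_neq0|exact: germ_regV].
  move=> m U g Om F oU rg oOm dF.
  by split; [exact: germ_opn_preimage|exact: germ_reg_comp].
Qed.

(* Only the germs at t0 matter: a curve which is continuous at t0 is then a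
   morphism, in both categories. *)
Definition germ_space : fspace R k T := Fspace germ_axioms.

End GermSpace.

(** * Open subspaces *)

Lemma sval_inj (X : Type) (P : X -> Prop) : injective (@sval X P).
Proof. by move=> [x p] [y q] /= e; exact: eq_exist. Qed.

Section OpenSubspace.
Variables (R : realType) (k : category) (X : Type).
Variables (S : fspace R k X) (P : set X).
Hypothesis oP : opn S P.
Local Notation C := (Cplx R).
Local Notation XP := {x | P x}.

(** Regularity on a subset of [P] does not depend on values outside it, so the default [y0] is
    harmless. *)
Definition extend (Y : Type) (y0 : Y) (f : XP -> Y) (x : X) : Y :=
  if pselect (P x) is left p then f (exist P x p) else y0.

Lemma extend_sval Y (y0 : Y) f u : extend y0 f (sval u) = f u.
Proof.
case: u => x p; rewrite /extend /=; case: pselect => // q.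
by rewrite (Prop_irrelevance q p).
Qed.

Lemma image_sval_preimage (V : set X) :
  sval @` (@sval X P @^-1` V) = V `&` P.
Proof.
apply/seteqP; split=> [_ [[x p] /= Vx <-]//|x [Vx p]].
by exists (exist P x p).
Qed.

Lemma image_svalI (U V : set XP) :
  sval @` (U `&` V) = (sval @` U) `&` (sval @` V).
Proof.
apply/seteqP; split=> [_ [u [Uu Vu] <-]|_ [[u Uu <-] [v Vv /sval_inj e]]].
  by split; exists u.
by exists u => //; split=> //; rewrite -e.
Qed.

Lemma image_sval_extend (U : set XP) Y (y0 : Y) (f : XP -> Y) (A : set Y) :
  sval @` (U `&` f @^-1` A) = (sval @` U) `&` (extend y0 f) @^-1` A.
Proof.
apply/seteqP; split=> [_ [u [Uu Au] <-]|_ [[u Uu <-]]] /=.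
  by split; [exists u|rewrite extend_sval].
by rewrite extend_sval => Au; exists u.
Qed.

Lemma reg_image_sval (U : set XP) (f g : X -> C) :
  reg S (sval @` U) f -> (forall u, U u -> g (sval u) = f (sval u)) ->
  reg S (sval @` U) g.
Proof. by move=> rf e; apply: (reg_ext rf) => _ [u Uu <-]; exact: e. Qed.

(** A concrete structure on the open set [P], read off on images in [X]. It contains the
    restrictions of regular functions, hence by minimality the whole subspace structure; so sets
    open in the subspace are open in [X]. *)
Lemma open_subspace_axioms :
  fspace_axioms k (fun U : set XP => opn S (sval @` U))
    (fun U f => reg S (sval @` U) (extend 0 f)).
Proof.
have ax := fspaceP S; split.
- by rewrite -[setT](preimage_setT sval) image_sval_preimage setTI.
- by move=> U V oU oV; rewrite image_svalI; exact: (fs_setI ax).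
- move=> U hU; apply: (fs_union ax) => _ [u Uu <-].
  have [V [oV Vu VU]] := hU _ Uu; exists (sval @` V); split=> //.
  exact: image_subset.
- by move=> U f; exact: (fs_reg_open ax).
- move=> U f oU hU; apply: (fs_local ax) => // _ [u Uu <-].
  have [V [g [Vu rg e]]] := hU _ Uu.
  exists (sval @` V), (extend 0 g); split=> //.
  move=> _ [v Uv <-] [w Vw /sval_inj ewv]; rewrite !extend_sval.
  by apply: e => //; rewrite -ewv.
- have ext_reg := reg_image_sval; have st := fs_stable ax.
  case: k S ext_reg st => S' ext_reg.
    case=> s1 s2 s3 s4; split=> [U c oU|U f g rf rg|U f g rf rg|U f rf].
    + by apply: ext_reg (s1 _ c oU) _ => u _; rewrite extend_sval.
    + by apply: ext_reg (s2 _ _ _ rf rg) _ => u _; rewrite !extend_sval.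
    + by apply: ext_reg (s3 _ _ _ rf rg) _ => u _; rewrite !extend_sval.
    + rewrite (@image_sval_extend U C 0 f [set y | y != 0]).
      have [oU rU] := s4 _ _ rf; split; first exact: oU.
      apply: reg_ext rU _ => _ [[u _ <-] _]; by rewrite !extend_sval.
  move=> st m U g Om F oU rg oOm dF.
  rewrite (@image_sval_extend U 'rV[C]_m 0 g Om).
  have [|oU' rU'] := st m (sval @` U) (extend 0 g) Om F oU _ oOm dF.
    by move=> j; apply: ext_reg (rg j) _ => u _; rewrite !extend_sval.
  split; first exact: oU'.
  by apply: reg_ext rU' _ => _ [[u _ <-] _]; rewrite /= !extend_sval.
Qed.

Lemma open_subspace_gens V f : pullback_gens S sval V f ->
  reg S (sval @` V) (extend 0 f).
Proof.
move=> [U [g [rg -> ->]]]; rewrite image_sval_preimage.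
have oU := fs_reg_open (fspaceP S) rg.
apply: (@reg_ext _ _ _ _ _ g).
  apply: reg_restrict rg (fs_setI (fspaceP S) oU oP) _.
  exact: subIsetl.
by move=> x [_ p]; rewrite (@extend_sval _ 0 _ (exist P x p)).
Qed.

Lemma opn_image_sval V : opn (Defs.subspace S P) V -> opn S (sval @` V).
Proof.
by move=> /(_ _ _ open_subspace_axioms); apply; exact: open_subspace_gens.
Qed.

Lemma reg_extend V f :
  reg (Defs.subspace S P) V f -> reg S (sval @` V) (extend 0 f).
Proof.
by move=> /(_ _ _ open_subspace_axioms); apply; exact: open_subspace_gens.
Qed.

End OpenSubspace.

(** * The open orbit of a smooth toric variety *)

Section DualBasis.
Variables (n : nat) (B : 'M[int]_n).
Hypothesis Bunit : B \in unitmx.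
Implicit Type m : 'rV[int]_n.

(** The pairing of [m] with the [i]-th row of [B]. As [B] is invertible, its rows form a Z-basis of
    N, and [dual_basis] is the dual basis of M. *)
Definition dual_coord m (i : 'I_n) : int := (m *m B^T) ord0 i.

Definition dual_basis (i : 'I_n) : 'rV[int]_n := row i (invmx B^T).

Lemma dual_coord0 i : dual_coord 0 i = 0.
Proof. by rewrite /dual_coord mul0mx mxE. Qed.

Lemma dual_coordD m m' i :
  dual_coord (m + m') i = dual_coord m i + dual_coord m' i.
Proof. by rewrite /dual_coord mulmxDl mxE. Qed.

Lemma dual_coordN m i : dual_coord (- m) i = - dual_coord m i.
Proof. by rewrite /dual_coord mulNmx mxE. Qed.

Lemma dual_coord_sum (J : finType) (P : pred J) (F : J -> 'rV[int]_n) i :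
  dual_coord (\sum_(j | P j) F j) i = \sum_(j | P j) dual_coord (F j) i.
Proof. by rewrite /dual_coord mulmx_suml summxE. Qed.

Lemma dual_coord_basis i j : dual_coord (dual_basis i) j = (i == j)%:R.
Proof.
by rewrite /dual_coord /dual_basis -row_mul mulVmx ?unitmx_tr// !mxE.
Qed.

Lemma sum_coord m : m = \sum_i dual_coord m i *: dual_basis i.
Proof. by rewrite -mulmx_sum_row mulmxK ?unitmx_tr. Qed.

Lemma dual_coord_row m i : dual_coord m i = \sum_j m ord0 j * (row i B) ord0 j.
Proof. by rewrite /dual_coord mxE; apply: eq_bigr => j _; rewrite !mxE. Qed.

End DualBasis.

(** * Smooth cones and their dual monoids *)

Section SmoothCone.
Variables (R : realType) (n : nat) (B : 'M[int]_n) (I : {set 'I_n}).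
Hypothesis Bunit : B \in unitmx.
Local Notation sigma := (@cone_over R _ [seq row i B | i <- enum I]).

Lemma pairing_lattice_cone (s : seq 'rV[int]_n) (c : 'I_(size s) -> R) m :
  pairing (lattice_vector R m)
    (\sum_(j < size s) c j *: lattice_vector R (nth 0 s j)) =
  \sum_(j < size s)
     c j * (\sum_k m ord0 k * (nth 0 s j) ord0 k)%:~R.
Proof.
rewrite /pairing.
under eq_bigr do rewrite summxE mulr_sumr.
rewrite exchange_big; apply: eq_bigr => j _.
rewrite rmorph_sum mulr_sumr; apply: eq_bigr => k _.
by rewrite !mxE rmorphM mulrCA.
Qed.

Lemma mem_cone_over (s : seq 'rV[int]_n) (v : 'rV[int]_n) :
  v \in s -> @cone_over R _ s (lattice_vector R v).
Proof.
move=> vs; have lt_vs : (index v s < size s)%N by rewrite index_mem.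
exists (fun j => (j == Ordinal lt_vs)%:R) => [j|]; first exact: ler0n.
rewrite (bigD1 (Ordinal lt_vs))//= eqxx scale1r nth_index// big1 ?addr0//.
by move=> j /negPf ->; rewrite scale0r.
Qed.

Lemma smooth_cone_nth (j : 'I_(size [seq row i B | i <- enum I])) :
  exists2 i, i \in I & nth 0 [seq row i B | i <- enum I] j = row i B.
Proof.
have /mapP[i] := mem_nth 0 (ltn_ord j); rewrite mem_enum => iI e.
by exists i.
Qed.

Lemma pairing_lattice_row m i :
  pairing (lattice_vector R m) (lattice_vector R (row i B)) =
  (dual_coord B m i)%:~R.
Proof.
rewrite dual_coord_row rmorph_sum /pairing; apply: eq_bigr => k _.
by rewrite rmorphM !mxE.
Qed.

(** A linear form is nonnegative on a cone as soon as it is so on the generators. In the dual basis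
    the monoid is thus a product of copies of the natural numbers, over [I], and of Z, off [I]. *)
Lemma smooth_cone_dual m :
  dual_monoid sigma m <-> forall i, i \in I -> 0 <= dual_coord B m i.
Proof.
split=> [dm i iI|dm v [c c0 ->]].
  rewrite -(ler0z R) -pairing_lattice_row; apply/dm/mem_cone_over.
  by apply/mapP; exists i; rewrite ?mem_enum.
rewrite pairing_lattice_cone; apply: sumr_ge0 => j _; apply: mulr_ge0 => //.
by have [i iI ->] := smooth_cone_nth j; rewrite ler0z -dual_coord_row dm.
Qed.

(** This form takes the value 1 on every generator of [sigma]. It exhibits {0} as a face, and its
    character is the local equation of the complement of the open orbit. *)
Definition dual_sum : 'rV[int]_n := \sum_(i in I) dual_basis B i.

Lemma dual_coord_dual_sum i : dual_coord B dual_sum i = (i \in I)%:R.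
Proof.
rewrite dual_coord_sum; case: (boolP (i \in I)) => iI.
  rewrite (bigD1 i)//= dual_coord_basis// eqxx big1 ?addr0// => j /andP[_ ji].
  by rewrite dual_coord_basis// (negPf ji).
rewrite big1// => j jI; rewrite dual_coord_basis//.
by case: eqP jI iI => // -> ->.
Qed.

Lemma smooth_cone_face0 : is_face [set 0] sigma.
Proof.
(* [u] sends a combination of the generators to the sum of its coefficients; when these are
   nonnegative, the sum vanishes only if all of them do. *)
pose u := lattice_vector R dual_sum.
have uE (c : 'I_(size [seq row i B | i <- enum I]) -> R) :
    pairing u (\sum_j c j *: lattice_vector R
    (nth 0 [seq row i B | i <- enum I] j)) = \sum_j c j.
  rewrite pairing_lattice_cone; apply: eq_bigr => j _.
  have [i iI ->] := smooth_cone_nth j.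
  by rewrite -dual_coord_row dual_coord_dual_sum iI mulr1.
exists u; split=> [v [c c0 ->]|]; first by rewrite uE; exact: sumr_ge0.
apply/seteqP; split=> [_ ->|v [[c c0 ->]]] /=.
  split; first exists (fun=> 0) => //.
    by rewrite big1// => j _; rewrite scale0r.
  by rewrite /pairing big1// => i _; rewrite [X in _ * X]mxE mulr0.
rewrite uE => /psumr_eq0P c_eq0; rewrite big1// => j _.
by rewrite c_eq0 ?scale0r.
Qed.

End SmoothCone.

(** * Coordinates on the affine chart of a smooth cone *)

Section AffineToric.
Variables (R : realType) (n : nat) (sigma : set 'rV[R]_n).
Local Notation C := (Cplx R).
Implicit Types (xi : affine_toric sigma) (m : 'rV[int]_n).

Lemma affine_toric_ext xi xi' :
  (forall m, dual_monoid sigma m -> xi m = xi' m) -> xi = xi'.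
Proof.
case: xi xi' => [f fo f1 fM] [g go g1 gM] /= e.
have fg : f = g.
  apply: funext => m; have [dm|dm] := pselect (dual_monoid sigma m).
    exact: e.
  by rewrite fo// go.
case: _ / fg in go g1 gM e *; congr AffineToric; exact: Prop_irrelevance.
Qed.

(** Multiplicativity gives [xi m * xi (- m) = xi 0 = 1]. *)
Lemma affine_toric_neq0 xi m :
  dual_monoid sigma m -> dual_monoid sigma (- m) -> xi m != 0.
Proof.
move=> dm dNm; apply/eqP => xi0; have := at_one xi.
rewrite -(subrr m) at_mul// xi0 mul0r => /esym/eqP.
by rewrite oner_eq0.
Qed.

Variables (B : 'M[int]_n) (I : {set 'I_n}).
Hypothesis Bunit : B \in unitmx.
(** This form covers both a smooth cone and the cone {0}, for which [I] is empty. *)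
Hypothesis dualP : forall m,
  dual_monoid sigma m <-> forall i, i \in I -> 0 <= dual_coord B m i.

Lemma dual_monoid0 : dual_monoid sigma 0.
Proof. by apply/dualP => i _; rewrite dual_coord0. Qed.

Lemma dual_monoidD m m' : dual_monoid sigma m -> dual_monoid sigma m' ->
  dual_monoid sigma (m + m').
Proof.
move=> /dualP dm /dualP dm'; apply/dualP => i iI.
by rewrite dual_coordD addr_ge0 ?dm ?dm'.
Qed.

Lemma dual_monoid_basis i : dual_monoid sigma (dual_basis B i).
Proof. by apply/dualP => j _; rewrite dual_coord_basis. Qed.

Lemma dual_monoidN_basis i :
  i \notin I -> dual_monoid sigma (- dual_basis B i).
Proof.
move=> iI; apply/dualP => j jI; rewrite dual_coordN dual_coord_basis//.
by case: eqP iI jI => [-> /negPf -> //|_ _ _]; rewrite oppr0.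
Qed.

Lemma affine_toric_basis_neq0 xi i : i \notin I -> xi (dual_basis B i) != 0.
Proof.
by move=> iI; apply: affine_toric_neq0;
  [exact: dual_monoid_basis|exact: dual_monoidN_basis].
Qed.

Lemma affine_toricX xi m k : dual_monoid sigma m ->
  dual_monoid sigma (k%:Z *: m) /\ xi (k%:Z *: m) = xi m ^+ k.
Proof.
move=> dm; elim: k => [|k [dk IH]].
  by rewrite scale0r expr0 at_one; split=> //; exact: dual_monoid0.
rewrite intS scalerDl scale1r exprS -IH.
by split; [exact: dual_monoidD|exact: at_mul].
Qed.

Lemma affine_toricXz xi i (a : int) : (i \in I -> 0 <= a) ->
  dual_monoid sigma (a *: dual_basis B i) /\
  xi (a *: dual_basis B i) = xi (dual_basis B i) ^ a.
Proof.
case: a => [k _|k]; first exact: affine_toricX (dual_monoid_basis i).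
(* A negative multiple occurs only off [I], where the opposite of the basis vector is also in the
   monoid; it is treated as a positive multiple of that opposite. *)
move=> a0; have iI : i \notin I by apply/negP => /a0.
have dN := dual_monoidN_basis iI; have di := dual_monoid_basis i.
have [dk e] := affine_toricX xi k.+1 dN.
rewrite NegzE scaleNr -scalerN; split=> //.
rewrite e -exprnN -exprVn; congr (_ ^+ _).
apply: (mulfI (affine_toric_basis_neq0 xi iI)).
by rewrite -at_mul// subrr at_one mulfV// affine_toric_basis_neq0.
Qed.

(** The characters of the dual basis are thus coordinates on the chart, those off [I] being nonzero:
    the chart is C^I times a torus. *)
Lemma affine_toric_prod xi m : dual_monoid sigma m ->
  xi m = \prod_i xi (dual_basis B i) ^ dual_coord B m i.
Proof.
move=> /dualP dm; rewrite [in LHS](sum_coord Bunit m).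
suff [] : dual_monoid sigma (\sum_i dual_coord B m i *: dual_basis B i) /\
  xi (\sum_i dual_coord B m i *: dual_basis B i) =
    \prod_i xi (dual_basis B i) ^ dual_coord B m i by [].
(* Membership in the monoid is carried through the induction, since [xi] is multiplicative only
   there. *)
apply: (big_rec2 (fun v y => dual_monoid sigma v /\ xi v = y)).
  by split; [exact: dual_monoid0|exact: at_one].
move=> i y v _ [dv ev]; have [di ei] := affine_toricXz xi (dm i).
by split; [exact: dual_monoidD|rewrite at_mul// ei ev].
Qed.

(** Exponents add up off [I] because [y i] is nonzero, and on [I] because both exponents are
    nonnegative. *)
Lemma prod_coordD (y : 'I_n -> C) m m' :
  (forall i, i \notin I -> y i != 0) ->
  dual_monoid sigma m -> dual_monoid sigma m' ->
  \prod_i y i ^ dual_coord B (m + m') i =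
  (\prod_i y i ^ dual_coord B m i) * \prod_i y i ^ dual_coord B m' i.
Proof.
move=> y0 /dualP dm /dualP dm'; rewrite -big_split; apply: eq_bigr => i _.
rewrite dual_coordD; have [iI|/y0 yi] := boolP (i \in I); last exact: expfzDr.
have := dm _ iI; have := dm' _ iI.
case: (dual_coord B m i) => // a; case: (dual_coord B m' i) => // b _ _.
exact: exprD.
Qed.

Section Point.
Variable y : 'I_n -> C.
Hypothesis y_neq0 : forall i, i \notin I -> y i != 0.

(** Converse of [affine_toric_prod]: the point with prescribed coordinates [y], extended by 0 as
    [at_out] demands. *)
Definition point_val m : C :=
  if pselect (dual_monoid sigma m) then \prod_i y i ^ dual_coord B m i else 0.

Lemma point_valE m :
  dual_monoid sigma m -> point_val m = \prod_i y i ^ dual_coord B m i.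
Proof. by rewrite /point_val; case: pselect. Qed.

Lemma point_out m : ~ dual_monoid sigma m -> point_val m = 0.
Proof. by rewrite /point_val; case: pselect. Qed.

Lemma point_one : point_val 0 = 1.
Proof.
rewrite point_valE; last exact: dual_monoid0.
by apply: big1 => i _; rewrite dual_coord0.
Qed.

Lemma point_mul m m' : dual_monoid sigma m -> dual_monoid sigma m' ->
  point_val (m + m') = point_val m * point_val m'.
Proof.
move=> dm dm'; rewrite !point_valE//; first exact: prod_coordD.
exact: dual_monoidD.
Qed.

Definition toric_point : affine_toric sigma :=
  AffineToric point_out point_one point_mul.

Lemma toric_pointE m : dual_monoid sigma m ->
  toric_point m = \prod_i y i ^ dual_coord B m i.
Proof. exact: point_valE. Qed.

End Point.

Variable xi : affine_toric sigma.

(* The vanishing coordinates of xi are replaced by the parameter s. *)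
Definition curve_coord (s : C) (i : 'I_n) : C :=
  if xi (dual_basis B i) == 0 then s else xi (dual_basis B i).

Lemma curve_coord_neq0 s i : i \notin I -> curve_coord s i != 0.
Proof.
move=> /(affine_toric_basis_neq0 xi) xi0.
by rewrite /curve_coord (negPf xi0).
Qed.

Definition toric_curve (s : C) : affine_toric sigma :=
  toric_point (curve_coord_neq0 s).

Lemma curveE s m : dual_monoid sigma m ->
  toric_curve s m = \prod_i curve_coord s i ^ dual_coord B m i.
Proof. exact: point_valE. Qed.

Lemma curve0 : toric_curve 0 = xi.
Proof.
apply: affine_toric_ext => m dm; rewrite curveE// affine_toric_prod//.
by apply: eq_bigr => i _; rewrite /curve_coord; case: eqP => // ->.
Qed.

Lemma curve_basis_neq0 s i : s != 0 -> toric_curve s (dual_basis B i) != 0.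
Proof.
move=> s0; rewrite curveE; last exact: dual_monoid_basis.
apply/prodf_neq0 => j _; apply: expfz_neq0.
by rewrite /curve_coord; case: ifPn.
Qed.

(** Along the curve a character is a constant times a power of [s]. The exponent is nonnegative,
    since a coordinate of [xi] can vanish only for an index in [I]. *)
Lemma curve_morphism :
  morphism (germ_space R Algebraic (0 : C)) (affine_toric_space sigma)
    toric_curve.
Proof.
apply: morphism_generated => U h [-> [m dm ->]].
rewrite preimage_setT.
have -> : (fun x : affine_toric sigma => x m) \o toric_curve =
    fun s => \prod_i curve_coord s i ^ dual_coord B m i.
  by apply: funext => s; exact: curveE.
apply: (@germ_reg_prod C) => [|i _]; first by move=> _; exact: filterT.
rewrite /curve_coord; case: eqP => [xi0|_]; last first.
  by apply: germ_reg_cst => _; exact: filterT.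
have iI : i \in I by apply/negPn/negP => /(affine_toric_basis_neq0 xi)/eqP.
have /dualP/(_ i iI) := dm; case: (dual_coord B m i) => // k _.
by apply: (@germ_regX C); apply: germ_reg_id => _; exact: filterT.
Qed.

End AffineToric.

Lemma isomorphism_inverse (R : realType) (k : category) (X Y : Type)
    (SX : fspace R k X) (SY : fspace R k Y) (f : X -> Y) :
  isomorphism SX SY f ->
  exists g, [/\ morphism SY SX g, cancel f g & cancel g f].
Proof. by move=> [g [_ mg fK gK]]; exists g. Qed.

Lemma dual_coord1 n (m : 'rV[int]_n) i : dual_coord 1%:M m i = m ord0 i.
Proof. by rewrite /dual_coord trmx1 mulmx1. Qed.

(* The cone {0} as the smooth cone on the empty part of a basis. *)
Lemma zero_cone_dual (R : realType) n (B : 'M[int]_n) (m : 'rV[int]_n) :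
  dual_monoid [set (0 : 'rV[R]_n)] m <->
  forall i, i \in (finset.set0 : {set 'I_n}) -> 0 <= dual_coord B m i.
Proof.
split=> [_ i|_ v ->]; first by rewrite finset.in_set0.
by rewrite /pairing big1// => i _; rewrite [X in _ * X]mxE mulr0.
Qed.

(** * The chart of the zero cone as the open orbit *)

Section ToricVariety.
Variables (R : realType) (n : nat) (Sigma : set (set 'rV[R]_n)).
Variables (X : Type) (S : fspace R Algebraic X) (act : torus R n -> X -> X).
Local Notation C := (Cplx R).
Hypothesis smooth : smooth_fan Sigma.
Variables (U : set 'rV[R]_n -> set X).
Variable phi : forall sigma, {x | U sigma x} -> affine_toric sigma.
Hypothesis U_chart : forall sigma, Sigma sigma -> opn S (U sigma) /\
  isomorphism (Defs.subspace S (U sigma)) (affine_toric_space sigma)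
    (@phi sigma).
Hypothesis U_cover : forall x, exists2 sigma, Sigma sigma & U sigma x.
Hypothesis U_inter : forall sigma tau, Sigma sigma -> Sigma tau ->
  U (sigma `&` tau) = U sigma `&` U tau.
Hypothesis phi_face : forall sigma tau, Sigma sigma -> Sigma tau ->
  is_face tau sigma ->
  forall x (xs : U sigma x) (xt : U tau x) m, dual_monoid sigma m ->
    phi (exist _ x xt) m = phi (exist _ x xs) m.
Hypothesis phi_act : forall sigma, Sigma sigma ->
  forall t x (xs : U sigma x),
    exists txs : U sigma (act t x), forall m, dual_monoid sigma m ->
      phi (exist _ (act t x) txs) m = torus_char m t * phi (exist _ x xs) m.

(** The chart of the cone {0} is Spec C[M], a copy of the torus. *)
Local Notation orbit := (U [set 0]).

Lemma zero_face sigma : Sigma sigma -> is_face [set 0] sigma.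
Proof. by move=> /smooth.2[B [I [uB ->]]]; exact: smooth_cone_face0. Qed.

Lemma zero_cone : Sigma [set 0].
Proof.
have [sigma Ss] := fan_nonempty smooth.1.
exact: (fan_faces smooth.1 Ss (zero_face Ss)).
Qed.

Lemma orbit_sub sigma : Sigma sigma -> orbit `<=` U sigma.
Proof.
move=> Ss; have <- : [set 0] `&` sigma = [set 0].
  have [u [_ ->]] := zero_face Ss.
  by apply/seteqP; split=> [v []//|v vs]; split=> //; case: vs.
by rewrite (U_inter zero_cone Ss) => y [].
Qed.

(** Nonzero coordinates also define a point [eta] of the chart of {0}. The point of the orbit that
    it represents has the same coordinates as [y] in the chart of [sigma], hence equals [y]. *)
Lemma orbit_of_neq0 sigma B (I : {set 'I_n}) y (ys : U sigma y) :
  Sigma sigma -> B \in unitmx ->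
  (forall m,
     dual_monoid sigma m <-> forall i, i \in I -> 0 <= dual_coord B m i) ->
  (forall i, phi (exist _ y ys) (dual_basis B i) != 0) -> orbit y.
Proof.
move=> Ss uB dualP xi0; have dual0 := @zero_cone_dual R n B.
pose eta := toric_point dual0 (fun i _ => xi0 i).
have [psi [_ _ psiK]] := isomorphism_inverse (U_chart zero_cone).2.
have [psis [_ phiK _]] := isomorphism_inverse (U_chart Ss).2.
case e : (psi eta) => [y' oy'].
have ys' := orbit_sub Ss oy'.
suff [<-] : exist (U sigma) y' ys' = exist _ y ys by [].
apply: (can_inj phiK); apply: affine_toric_ext => m dm.
rewrite -(phi_face Ss zero_cone (zero_face Ss) ys' oy' dm) -e psiK.
rewrite (affine_toric_prod uB dualP)// toric_pointE//.
by apply/dual0 => i; rewrite finset.in_set0.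
Qed.

Lemma neq0_of_orbit sigma y (ys : U sigma y) m : Sigma sigma -> orbit y ->
  dual_monoid sigma m -> phi (exist _ y ys) m != 0.
Proof.
move=> Ss oy dm; rewrite -(phi_face Ss zero_cone (zero_face Ss) ys oy dm).
(* The dual monoid of {0} is all of M, so it contains both [m] and its opposite. *)
by apply: affine_toric_neq0; apply/(zero_cone_dual _ 0) => i;
  rewrite finset.in_set0.
Qed.

Lemma orbit_nonempty : orbit !=set0.
Proof.
have [psi _] := isomorphism_inverse (U_chart zero_cone).2.
have dual0 := @zero_cone_dual R n 1%:M.
(* The witness has all coordinates 1: it is the identity of the torus. *)
have y0 i : i \notin (finset.set0 : {set 'I_n}) -> (1 : C) != 0.
  by rewrite oner_eq0.
by have [y oy] := psi (toric_point dual0 y0); exists y.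
Qed.

Lemma orbit_transitive x y : orbit x -> orbit y -> exists t, act t x = y.
Proof.
move=> ox oy; have dual0 := @zero_cone_dual R n 1%:M.
have [psi [_ phiK _]] := isomorphism_inverse (U_chart zero_cone).2.
pose xi := phi (exist _ x ox); pose eta := phi (exist _ y oy).
have nz (z : affine_toric [set (0 : 'rV[R]_n)]) i : z (dual_basis 1%:M i) != 0.
  by apply: (affine_toric_basis_neq0 (unitmx1 _ _) dual0);
     rewrite finset.in_set0.
(* The torus element carrying [x] to [y] has as entries the quotients of their coordinates in the
   standard basis. *)
have t0 i : eta (dual_basis 1%:M i) / xi (dual_basis 1%:M i) != 0.
  by rewrite mulf_neq0 ?invr_neq0.
exists (Torus t0); have [otx actE] := phi_act zero_cone (Torus t0) ox.
suff [] : exist orbit _ otx = exist _ y oy by [].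
apply: (can_inj phiK); apply: affine_toric_ext => m dm.
rewrite actE// !(affine_toric_prod (unitmx1 _ _) dual0 _ dm) /torus_char.
rewrite -big_split; apply: eq_bigr => i _.
have <- : torus_val (Torus t0) i * xi (dual_basis 1%:M i) =
    eta (dual_basis 1%:M i) by rewrite divfK.
by rewrite dual_coord1; exact: esym (expfzMl _ _ _).
Qed.

(** On the chart of [sigma] take for [h] the character of [dual_sum]: it is the product of the
    coordinates indexed by [I], the only ones that can vanish. *)
Lemma orbit_local_equation x : exists V h,
  [/\ V x, reg S V h & forall y, V y -> orbit y <-> h y != 0].
Proof.
have [sigma Ss xs] := U_cover x; have [oU [_ [[_ mphi] _ _ _]]] := U_chart Ss.
have [B [I [uB sE]]] := smooth.2 _ Ss.
have dualP m :
    dual_monoid sigma m <-> forall i, i \in I -> 0 <= dual_coord B m i.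
  by rewrite sE; exact: smooth_cone_dual.
pose m0 := dual_sum B I.
have dm0 : dual_monoid sigma m0.
  by apply/dualP => i _; rewrite dual_coord_dual_sum.
exists (sval @` (@phi sigma @^-1` setT)), (extend 0 (fun u => @phi sigma u m0)).
split.
- by exists (exist _ x xs).
- apply: (reg_extend oU); apply: mphi (fun z : affine_toric sigma => z m0) _.
  by apply: reg_generated; split=> //; exists m0.
move=> _ [[y ys] _ <-]; rewrite extend_sval /=; split=> [oy|].
  exact: neq0_of_orbit.
rewrite (affine_toric_prod uB dualP)// => /prodf_neq0 nz.
apply: (orbit_of_neq0 (ys := ys) Ss uB dualP) => i.
have [iI|iI] := boolP (i \in I); last exact: (affine_toric_basis_neq0 uB dualP).
by have := nz i isT; rewrite dual_coord_dual_sum// iI.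
Qed.

(** The inverse chart transports [toric_curve], all of whose coordinates are nonzero for nonzero
    [s]. *)
Lemma orbit_curve x : exists gamma : C -> X,
  [/\ gamma 0 = x, forall s : Cplx R, s != 0 -> orbit (gamma s) &
      morphism (germ_space R Algebraic (0 : C)) S gamma].
Proof.
have [sigma Ss xs] := U_cover x.
have [psi [mpsi phiK psiK]] := isomorphism_inverse (U_chart Ss).2.
have [B [I [uB sE]]] := smooth.2 _ Ss.
have dualP m :
    dual_monoid sigma m <-> forall i, i \in I -> 0 <= dual_coord B m i.
  by rewrite sE; exact: smooth_cone_dual.
pose cur := toric_curve uB dualP (phi (exist _ x xs)).
exists (fun s => sval (psi (cur s))); split.
- by rewrite /cur curve0 phiK.
- move=> s s0; case e : (psi (cur s)) => [y ys].
  apply: (orbit_of_neq0 (ys := ys) Ss uB dualP) => i.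
  by rewrite -e psiK; exact: curve_basis_neq0.
- apply: morphism_comp (morphism_sval _ _) _.
  by apply: morphism_comp mpsi _; exact: curve_morphism.
Qed.

End ToricVariety.

(** This gathers all the toric geometry that the bundle argument uses. *)
Lemma toric_open_orbit (R : realType) n X (S : fspace R Algebraic X)
    (act : torus R n -> X -> X) :
  nonsingular_toric_variety S act -> exists orbit : set X,
  [/\ orbit !=set0,
      forall x y, orbit x -> orbit y -> exists t, act t x = y,
      forall x, exists V h,
        [/\ V x, reg S V h & forall y, V y -> orbit y <-> h y != 0] &
      forall x, exists gamma : Cplx R -> X,
        [/\ gamma 0 = x, forall s : Cplx R, s != 0 -> orbit (gamma s) &
            morphism (germ_space R Algebraic (0 : Cplx R)) S gamma]].
Proof.
move=> [Sigma smooth [U [phi [chart cover inter face actE]]]].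
exists (U [set 0]); split.
- exact: (orbit_nonempty smooth chart).
- exact: (orbit_transitive smooth chart actE).
- exact: (orbit_local_equation smooth chart cover inter face).
- exact: (orbit_curve smooth chart cover inter face).
Qed.

(** * Density of the open orbit and equivariant bundles *)

Lemma nbhs0_neq0 (K : numFieldType) (A : set K) :
  nbhs 0 A -> exists2 s, s != 0 & A s.
Proof.
move=> nA; have : \forall s \near (0 : K)^', A s /\ s != 0.
  by near=> s; split; near: s; [exact: nbhs_dnbhs|exact: nbhs_dnbhs_neq].
by move=> /filter_ex[s [As s0]]; exists s.
Unshelve. all: by end_near. Qed.

Lemma dense_of_curves (R : realType) (k : category) (X : Type)
    (SX : fspace R Algebraic X) (orbit : set X) :
  (forall x, exists gamma : Cplx R -> X,
     [/\ gamma 0 = x, forall s : Cplx R, s != 0 -> orbit (gamma s) &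
         morphism (germ_space R Algebraic (0 : Cplx R)) SX gamma]) ->
  forall W x, opn (realization k SX) W -> W x -> exists2 y, W y & orbit y.
Proof.
move=> curves W x oW Wx; have [gamma [g0 go [mo mr]]] := curves x.
have : opn (germ_space R k (0 : Cplx R)) (gamma @^-1` W).
  (* A classical open set is open for the structure generated by regular functions, and [gamma]
     pulls these back to germs continuous at 0. *)
  case: k oW => oW; first exact: mo.
  by apply: opn_generated oW => U f; exact: mr.
rewrite -g0 in Wx => /(_ Wx) /nbhs0_neq0[s s0 Ws].
by exists (gamma s) => //; exact: go.
Qed.

(* The local equation h of the complement of the orbit is not a zero divisor
   in O_X, so by flatness its pullback is not a zero divisor upstairs. *)
Lemma flat_dense (R : realType) (Y X : Type) (SY : fspace R Algebraic Y)
    (SX : fspace R Algebraic X) (f : Y -> X) (orbit : set X) (y : Y) :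
  (forall W x, opn SX W -> W x -> exists2 x', W x' & orbit x') ->
  (exists V h, [/\ V (f y), reg SX V h &
     forall x, V x -> orbit x <-> h x != 0]) ->
  morphism SY SX f -> flat_at SY SX f y ->
  forall W, opn SY W -> W y -> exists2 w, W w & orbit (f w).
Proof.
move=> dense [V [h [Vfy rh hE]]] mf flat W oW Wy; apply: contrapT => noW.
have h0 w : W w -> V (f w) -> h (f w) = 0.
  move=> Ww Vfw; apply/eqP/negPn/negP => /(hE _ Vfw) ow.
  by apply: noW; exists w.
(* Flatness is applied to the single relation [h * 1 = 0]. It writes 1 as a combination of pulled
   back functions [c j] with [h * c j = 0]. *)
have [|s [U' [W' [c [d [[U'fy W'y] rc rd hc dc]]]]]] :=
    flat 1%N V W (fun=> h) (fun=> fun=> 1) Vfy Wy (fun=> rh)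
      (fun=> reg_cst 1 oW).
  by move=> w Ww Vfw; rewrite big_ord1 h0 ?mul0r.
(* The combination equals 1 at [y], so its terms cannot all vanish there. *)
have [j cj] : exists j, c ord0 j (f y) != 0.
  apply: contrapT => c0; have := dc ord0 y Wy W'y U'fy; rewrite big1.
    by move/eqP; rewrite oner_eq0.
  move=> j _; have [->|cj] := eqVneq (c ord0 j (f y)) 0; first exact: mul0r.
  by case: c0; exists j.
have [_ _ _ inv] := fs_stable (fspaceP SX).
have [oc _] := inv _ _ (rc ord0 j).
have oV := fs_reg_open (fspaceP SX) rh.
(* By density the orbit meets the open set where [c j] is nonzero; at such a point [h] is nonzero
   too, contradicting [h * c j = 0]. *)
have [x [Vx [U'x /= cx]] /(hE _ Vx) hx] :=
  dense _ (f y) (fs_setI (fspaceP SX) oV oc) (conj Vfy (conj U'fy cj)).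
have /eqP := hc j x Vx U'x.
by rewrite big_ord1 mulf_eq0 (negPf hx) (negPf cx).
Qed.

(** Both categories are put in one form: a trivializing map [f], etale or the inclusion of an open
    set, with a point [u] over [x] near which the preimage of the orbit accumulates. *)
Lemma locally_trivial_dense (R : realType) (k : category) (G : groupType)
    (E X : Type) (SG : fspace R k G) (SE : fspace R k E)
    (SX : fspace R Algebraic X) (pi : E -> X) (act : E -> G -> E)
    (orbit : set X) :
  (forall W x, opn (realization k SX) W -> W x ->
     exists2 x', W x' & orbit x') ->
  (forall x, exists V h, [/\ V x, reg SX V h &
     forall y, V y -> orbit y <-> h y != 0]) ->
  locally_trivial SG SE (realization k SX) pi act ->
  forall x, exists (U : Type) (SU : fspace R k U) (f : U -> X) (u : U),
    [/\ f u = x, trivial_along SG SE pi act SU f &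
        forall W, opn SU W -> W u -> exists2 u', W u' & orbit (f u')].
Proof.
case: k SG SE => SG SE dense eqn triv x.
  have [U [SU [f [_ [mf et] [u fu] tr]]]] := triv x.
  exists U, SU, f, u; split=> //.
  exact: (flat_dense dense (eqn _) mf (et u).1).
have [V [oV Vx tr]] := triv x.
exists {x | V x}, (Defs.subspace (realization Holomorphic SX) V), sval,
  (exist _ x Vx); split=> // W oW Wx.
have [|_ [u Wu <-] ou] := dense _ x (opn_image_sval oV oW); last by exists u.
by exists (exist _ x Vx).
Qed.

(** * Consequences of triviality along a map *)

Section TrivialAlong.
Variables (R : realType) (k : category) (G : groupType) (E X U : Type).
Variables (SG : fspace R k G) (SE : fspace R k E) (SU : fspace R k U).
Variables (pi : E -> X) (act : E -> G -> E) (f : U -> X).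
Hypothesis triv : trivial_along SG SE pi act SU f.

Lemma trivial_fiber_nonempty u : exists z, pi z = f u.
Proof.
have [Phi [_ Phi1 _]] := triv; exists (sval (Phi (u, 1%g))).2.
by rewrite -(svalP (Phi (u, 1%g))) Phi1.
Qed.

(** The fiber product is eliminated: the second component of [Phi] parametrizes the fibers of [pi]
    over the image of [f] equivariantly. *)
Lemma trivial_coordinate :
  exists2 Phi : U * G -> {p : U * E | f p.1 = pi p.2}, injective Phi &
  [/\ morphism (product SU SG) SE (fun p => (sval (Phi p)).2),
      forall u g, (sval (Phi (u, g))).1 = u,
      forall u g h, (sval (Phi (u, (g * h)%g))).2 =
        act (sval (Phi (u, g))).2 h &
      forall u z, pi z = f u -> exists g, (sval (Phi (u, g))).2 = z].
Proof.
have [Phi [[Psi [mPhi _ PhiK PsiK]] Phi1 PhiM]] := triv.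
exists Phi; first exact: can_inj PhiK.
split=> // [|u z zu].
  exact: morphism_comp (morphism_snd _ _)
    (morphism_comp (morphism_sval _ _) mPhi).
pose p := exist (fun p => f p.1 = pi p.2) (u, z) (esym zu).
case e : (Psi p) => [v g]; have e' : Phi (v, g) = p by rewrite -e PsiK.
by exists g; have := Phi1 v g; rewrite e' /= => ->; rewrite e'.
Qed.

Lemma trivial_transitive u z z' : pi z = f u -> pi z' = f u ->
  exists g, z' = act z g.
Proof.
have [Phi _ [_ _ PhiM lift]] := trivial_coordinate.
move=> /lift[g <-] /lift[g' <-].
by exists (g^-1 * g')%g; rewrite -PhiM mulVKg.
Qed.

Lemma trivial_free u z g h : pi z = f u -> act z g = act z h -> g = h.
Proof.
have [Phi PhiI [_ Phi1 PhiM lift]] := trivial_coordinate.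
move=> /lift[g0 <-].
rewrite -!PhiM => e; apply: (@mulgI _ g0).
(* The two points of the fiber product share their first component [u], so equality in [E]
   suffices. *)
suff /PhiI[] : Phi (u, (g0 * g)%g) = Phi (u, (g0 * h)%g) by [].
apply: sval_inj; move: e (Phi1 u (g0 * g)%g) (Phi1 u (g0 * h)%g).
by case: (sval _) => a b; case: (sval _) => a' b' /= -> -> ->.
Qed.

Lemma trivial_section u z : pi z = f u -> exists s : U -> E,
  [/\ morphism SU SE s, s u = z & forall v, pi (s v) = f v].
Proof.
have [Phi _ [mPhi Phi1 _ lift]] := trivial_coordinate.
move=> /lift[g gz].
(* The constant section of the trivialization through the coordinate [g] of [z]. *)
exists (fun v => (sval (Phi (v, g))).2); split=> // [|v].
  exact: morphism_comp mPhi
    (morphism_pair (morphism_id _) (morphism_cst _ _ g)).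
by rewrite -(svalP (Phi (v, g))) Phi1.
Qed.

End TrivialAlong.

(** * Fibers and automorphisms of the bundle *)

Section EquivariantBundle.
Variables (R : realType) (k : category) (G : groupType).
Variables (SG : fspace R Algebraic G) (n : nat) (X : Type).
Variables (SX : fspace R Algebraic X) (actX : torus R n -> X -> X).
Variable E : equivariant_bundle k SG SX actX.
Variable orbit : set X.
Hypothesis orbit_trans :
  forall x y, orbit x -> orbit y -> exists t, actX t x = y.
Hypothesis triv : forall x,
  exists (U : Type) (SU : fspace R k U) (f : U -> X) (u : U),
    [/\ f u = x,
        trivial_along (realization k SG) (total_space E)
          (@Defs.proj _ _ _ _ _ _ _ _ E)
          (@actG _ _ _ _ _ _ _ _ E) SU f &
        forall W, opn SU W -> W u -> exists2 u', W u' & orbit (f u')].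

Lemma bundle_fiber_nonempty x : exists z : Defs.total E, Defs.proj z = x.
Proof.
have [U [SU [f [u [<- tr _]]]]] := triv x.
exact: (trivial_fiber_nonempty tr u).
Qed.

Lemma bundle_transitive (z z' : Defs.total E) :
  Defs.proj z = Defs.proj z' -> exists g, z' = actG z g.
Proof.
move=> e; have [U [SU [f [u [fu tr _]]]]] := triv (Defs.proj z).
by apply: (trivial_transitive tr (u := u)); rewrite fu.
Qed.

Lemma bundle_free (z : Defs.total E) g h : actG z g = actG z h -> g = h.
Proof.
have [U [SU [f [u [fu tr _]]]]] := triv (Defs.proj z).
by apply: (trivial_free tr (u := u)); rewrite fu.
Qed.

(** A local section through [z] pulls [W] back to an open neighbourhood of [u], which has a point
    over the orbit. *)
Lemma bundle_dense W (z : Defs.total E) : opn (total_space E) W -> W z ->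
  exists2 z', W z' & orbit (Defs.proj z').
Proof.
move=> oW Wz; have [U [SU [f [u [fu tr dense]]]]] := triv (Defs.proj z).
have [s [[so _] su sE]] := trivial_section tr (esym fu).
have [|u' Wu' ou'] := dense _ (so _ oW); first by rewrite /= su.
by exists (s u') => //; rewrite sE.
Qed.

Lemma autT_morphism (a : autT E) : morphism (total_space E) (total_space E) a.
Proof. by have [? []] := autT_iso (autTP a). Qed.

Lemma autT_eq (a b : autT E) (z0 : Defs.total E) :
  orbit (Defs.proj z0) -> a z0 = b z0 -> a = b.
Proof.
move=> o0 ab0; apply: autT_inj => z; apply: contrapT => abz.
have oW := opn_setC_agree (total_geometric E) (autT_morphism a)
  (autT_morphism b).
have [z' /= abz' oz'] := bundle_dense oW abz; apply: abz'.
(* Torus and structure group together carry [z0] to any point over the orbit, and [a] and [b]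
   commute with both. *)
have [t tz0] := orbit_trans o0 oz'.
have [g ->] : exists g, z' = actG (actT t z0) g.
  by apply: bundle_transitive; rewrite proj_actT.
have [ga gb] := (autT_actG (autTP a), autT_actG (autTP b)).
have [ta tb] := (autT_actT (autTP a), autT_actT (autTP b)).
by rewrite ga gb ta tb ab0.
Qed.

(** Centrality of [c] makes right translation by [c] commute with the right action; its inverse is
    translation by the inverse of [c]. *)
Lemma actG_autT (c : G) :
  group_center c -> is_autT (fun z : Defs.total E => actG z c).
Proof.
move=> cc; have mor d : morphism (total_space E) (total_space E)
    (fun z => actG z d).
  exact: morphism_comp (actG_morphism E)
    (morphism_pair (morphism_id _) (morphism_cst _ _ d)).
split=> [|z|z g|t z].
- exists (fun z => actG z c^-1%g); split=> // z.
    by rewrite -actGM mulgV actG1.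
  by rewrite -actGM mulVg actG1.
- exact: proj_actG.
- by rewrite -!actGM (cc g).
- by rewrite actT_actG.
Qed.

End EquivariantBundle.

(** * The embedding of the automorphism group into G *)

Theorem lemma2p11 (R : realType) (k : category)
    (G : groupType) (SG : fspace R Algebraic G)
    (hG : linear_algebraic_group SG)
    (n : nat) (X : Type) (SX : fspace R Algebraic X)
    (actX : torus R n -> X -> X)
    (hX : nonsingular_toric_variety SX actX)
    (E : equivariant_bundle k SG SX actX) :
  exists rho : autT E -> G,
    [/\ {morph rho : a b / (a * b)%g >-> (a * b)%g},
        injective rho &
        forall c : G, group_center c -> exists a : autT E,
          (forall z, a z = actG z c) /\ rho a = c].
Proof.
have [orbit [[x0 ox0] trans eqn curves]] := toric_open_orbit hX.
have triv := locally_trivial_dense (dense_of_curves (k := k) curves) eqn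
  (bundle_locally_trivial E).
have [z0 z0x] := bundle_fiber_nonempty triv x0.
have oz0 : orbit (Defs.proj z0) by rewrite z0x.
(* [a z0] lies in the fiber of [z0], on which [G] acts transitively. *)
have /choice[rho rhoE] (a : autT E) : exists g, a z0 = actG z0 g.
  by apply: (bundle_transitive triv); rewrite (autT_proj (autTP a)).
exists rho; split=> [a b|a b ab|c cc].
(* Since [a] commutes with the right action, [a (b z0)] is [a z0] translated by [rho b], so the
   order of the factors is preserved. *)
- apply: (bundle_free triv (z := z0)); rewrite -rhoE actGM -rhoE.
  by rewrite -(autT_actG (autTP a)) -rhoE.
- by apply: (autT_eq trans triv oz0); rewrite !rhoE ab.
- exists (AutT (actG_autT E cc)); split=> //.
  by apply: (bundle_free triv (z := z0)); rewrite -rhoE.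
Qed.
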